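(* Let $n$ be a positive integer with $n\equiv 0,3,4 \pmod{6}$. Then there exists no almost perfect linear Lee code of packing radius $2$ in $\mathbb{Z}^n$.
   Context: For $r\ge 0$ let $S(n,r)=\{(x_1,\dots,x_n)\in\mathbb{Z}^n : \sum_{i=1}^n |x_i|\le r\}$ be the Lee sphere of radius $r$; one has $|S(n,2)|=2n^2+2n+1$. A linear Lee code is a subgroup (lattice) $C\subseteq\mathbb{Z}^n$ endowed with the Lee ($\ell_1$) distance. An almost perfect linear Lee code (APLL code) of packing radius $r$ is a linear Lee code $C\subseteq \mathbb{Z}^n$ such that the translates $S(n,r)+c$, $c\in C$, are pairwise disjoint (a lattice packing of $\mathbb{Z}^n$ by $S(n,r)$) and the density of this packing equals $\frac{|S(n,r)|}{|S(n,r)|+1}$; equivalently, the translates are pairwise disjoint and $[\mathbb{Z}^n:C]=|S(n,r)|+1$. *)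

(* Defs.v *)
From HB Require Import structures.
From mathcomp Require Import all_boot all_order all_algebra finmap.
From mathcomp Require Import boolp classical_sets functions cardinality.
From mathcomp Require Import zify.

Set Implicit Arguments.
Unset Strict Implicit.
Unset Printing Implicit Defensive.

Import Order.TTheory GRing.Theory Num.Theory.

Local Open Scope classical_set_scope.
Local Open Scope ring_scope.

Definition lee_weight n (x : 'rV[int]_n) : nat := (\sum_i `|x 0%R i|)%N.

Definition lee_sphere n (r : nat) : set 'rV[int]_n :=
  [set x | (lee_weight x <= r)%N].
Arguments lee_sphere : clear implicits.

Definition translate n (c : 'rV[int]_n) (A : set 'rV[int]_n) :
  set 'rV[int]_n := [set c + x | x in A].

Definition linear_lee_code n (C : set 'rV[int]_n) : Prop :=
  zmod_closed [pred x | x \in C].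

(* fset_set maps an infinite set to fset0, so the index of a subgroup of
   infinite index is 0 here. *)
Definition lattice_index n (C : set 'rV[int]_n) : nat :=
  #|` fset_set [set translate x C | x in [set: 'rV[int]_n]]|%N.

Definition lattice_packing n r (C : set 'rV[int]_n) : Prop :=
  trivIset C (fun c => translate c (lee_sphere n r)).

Definition card_lee_sphere n r : nat := #|` fset_set (lee_sphere n r)|%N.

(* The density |S(n,r)| / [Z^n : C] of a lattice packing; since x / 0 = 0, it
   is 0 when C has infinite index. *)
Definition packing_density n r (C : set 'rV[int]_n) : rat :=
  (card_lee_sphere n r)%:R / (lattice_index C)%:R.

Definition apll_code n r (C : set 'rV[int]_n) : Prop :=
  [/\ linear_lee_code C,
      lattice_packing r C
    & packing_density r C =
        (card_lee_sphere n r)%:R / (card_lee_sphere n r).+1%:R].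

Lemma finite_lee_sphere n r : finite_set (lee_sphere n r).
Proof.
pose f (u : {ffun 'I_n -> 'I_(r + r).+1}) : 'rV[int]_n :=
  \row_i ((u i : nat)%:Z - r%:Z).
apply: (@sub_finite_set _ _ (f @` setT)); last first.
  by apply: finite_image; exact: finite_finset.
move=> x /= xr; exists [ffun i => inord `|(x 0 i + r%:Z)%R|%N] => //.
apply/rowP => i; rewrite mxE ffunE.
have xi : (`|x 0%R i| <= r)%N.
  by apply: leq_trans xr; rewrite /lee_weight (bigD1 i) //= leq_addr.
rewrite inordK; first by lia.
by lia.
Qed.

Lemma card_lee_sphere_gt0 n r : (0 < card_lee_sphere n r)%N.
Proof.
rewrite /card_lee_sphere cardfs_gt0; apply/fset0Pn; exists 0.
rewrite in_fset_set; last exact: finite_lee_sphere.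
by rewrite inE /lee_sphere /= /lee_weight big1 // => i _; rewrite mxE.
Qed.

Lemma apll_codeP n r (C : set 'rV[int]_n) :
  apll_code r C <->
  [/\ linear_lee_code C, lattice_packing r C
    & lattice_index C = (card_lee_sphere n r).+1].
Proof.
split=> -[lC pC dC]; split=> //; last by rewrite /packing_density dC.
have S0 : (card_lee_sphere n r)%:R != 0 :> rat.
  by rewrite pnatr_eq0 -lt0n card_lee_sphere_gt0.
by move/(mulfI S0)/invr_inj/eqP: dC; rewrite eqr_nat => /eqP.
Qed.

(* Main.v *)
Require Import Defs.
From HB Require Import structures.
From mathcomp Require Import all_boot all_order all_algebra finmap.
From mathcomp Require Import boolp classical_sets functions cardinality.
From mathcomp Require Import zify ring.

(** In G = Z^n/C, of order 2N with N = n^2 + n + 1 odd, the set T of the classes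
    of 0 and the +-e_i has size 2n+1, and T + T misses a single element g, the
    unique involution.  In Z[G], writing S_k for the sum of the [k s], s in S,
    this reads T^2 + T_2 = 2G - 2g + 2n.  Let H be the subgroup of order N and
    write T = A + Bg with A, B in H.  Then A B = H - 1 and
    A^2 + B^2 + A_2 + B_2 = 2H + 2n, so {|A|, |B|} = {n, n+1}, with |A| odd.

    Reducing A^2 = A_2 and B^2 = B_2 mod 2, the coefficients of A_2 B are odd off A
    and those of A B_2 are odd on B; as their sums are as small as this allows,
    they are all equal to 1 there.  Reducing A^3 = A_3 and B^3 = B_3 mod 3, the
    quadratic relation multiplied by A (resp. B) then determines A A_2 + A_3
    mod 3 on B (resp. B B_2 + B_3 mod 3 off A and B).  If 3 | n, the first
    quantity is 2 mod 3, and its sum over B is at most 2(|A| - 1); this forces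
    |A| = n + 1 and A_3 = B + 1, and then A_2 + B_2 is 2 mod 3 on B, although its
    coefficients are at most 1.  If n = 4 mod 6, the second quantity is 2 mod 3,
    which makes its sum exceed n^2 + n. *)

Set Implicit Arguments.
Unset Strict Implicit.
Unset Printing Implicit Defensive.

Import Order.TTheory GRing.Theory Num.Theory.

Local Open Scope classical_set_scope.
Local Open Scope ring_scope.

(* The integral group ring Z[G], with convolution as product; a fresh name keeps
   it apart from the pointwise ring of finite functions. *)
Definition gring (G : finZmodType) := {ffun G -> int}.
HB.instance Definition _ (G : finZmodType) :=
  GRing.Zmodule.copy (gring G) {ffun G -> int}.

(** * Convolution, augmentation and the elements S_k in Z[G] *)

Section GroupRing.
Variable G : finZmodType.
Implicit Types u v w : gring G.

Definition gcoef u (x : G) : int := (u : {ffun G -> int}) x.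

Lemma gringP u v : gcoef u =1 gcoef v -> u = v.
Proof. by move=> uv; apply/ffunP. Qed.

Lemma gcoefD u v x : gcoef (u + v) x = gcoef u x + gcoef v x.
Proof. by rewrite /gcoef ffunE. Qed.

Lemma gcoefN u x : gcoef (- u) x = - gcoef u x.
Proof. by rewrite /gcoef ffunE. Qed.

Lemma gcoef0 x : gcoef 0 x = 0.
Proof. by rewrite /gcoef ffunE. Qed.

Lemma gcoefMn u k x : gcoef (u *+ k) x = gcoef u x *+ k.
Proof. by elim: k => [|k IH]; rewrite ?gcoef0 // !mulrS gcoefD IH. Qed.

Lemma gcoef_sum I (r : seq I) (P : pred I) (F : I -> gring G) x :
  gcoef (\sum_(i <- r | P i) F i) x = \sum_(i <- r | P i) gcoef (F i) x.
Proof. by apply: (big_morph (gcoef^~ x)) => [u v|]; rewrite (gcoefD, gcoef0). Qed.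

Definition delta (x : G) : gring G := [ffun y => (y == x)%:R].

Lemma gcoef_delta x y : gcoef (delta x) y = (y == x)%:R.
Proof. by rewrite /gcoef ffunE. Qed.

Definition conv u v : gring G := [ffun x => \sum_y gcoef u y * gcoef v (x - y)].

Lemma gcoef_conv u v x : gcoef (conv u v) x = \sum_y gcoef u y * gcoef v (x - y).
Proof. by rewrite /gcoef ffunE. Qed.

Lemma convC : commutative conv.
Proof.
move=> u v; apply: gringP => x; rewrite !gcoef_conv.
rewrite (reindex_inj (inv_inj (subKr x))) /=.
by apply: eq_bigr => y _; rewrite subKr mulrC.
Qed.

Lemma convA : associative conv.
Proof.
move=> u v w; apply: gringP => x; rewrite !gcoef_conv.
under eq_bigr do rewrite gcoef_conv mulr_sumr.
under [RHS]eq_bigr do rewrite gcoef_conv mulr_suml.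
rewrite [RHS]exchange_big /=; apply: eq_bigr => y _.
rewrite [RHS](reindex_inj (addrI y)) /=; apply: eq_bigr => z _.
by rewrite [y + z - y]addrC addKr opprD addrA mulrA.
Qed.

Lemma conv1 : left_id (delta 0) conv.
Proof.
move=> u; apply: gringP => x; rewrite gcoef_conv (bigD1 0) //= gcoef_delta eqxx.
rewrite subr0 mul1r big1 ?addr0 // => y /negbTE y0.
by rewrite gcoef_delta y0 mul0r.
Qed.

Lemma convDl : left_distributive conv +%R.
Proof.
move=> u v w; apply: gringP => x; rewrite gcoefD !gcoef_conv -big_split /=.
by apply: eq_bigr => y _; rewrite gcoefD mulrDl.
Qed.

Lemma delta0_neq0 : delta 0 != 0.
Proof.
apply/eqP => /(congr1 (gcoef^~ 0)); rewrite gcoef_delta gcoef0 eqxx.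
by move/eqP; rewrite oner_eq0.
Qed.

HB.instance Definition _ := GRing.Zmodule_isComNzRing.Build (gring G)
  convA convC conv1 convDl delta0_neq0.

Lemma gcoefM u v x : gcoef (u * v) x = \sum_y gcoef u y * gcoef v (x - y).
Proof. exact: gcoef_conv. Qed.

Lemma gcoef1 x : gcoef 1 x = (x == 0)%:R.
Proof. exact: gcoef_delta. Qed.

Lemma deltaD x y : delta (x + y) = delta x * delta y.
Proof.
apply: gringP => z; rewrite gcoefM (bigD1 x) //= !gcoef_delta eqxx mul1r.
rewrite big1 ?addr0 => [|t /negbTE tx]; last by rewrite gcoef_delta tx mul0r.
by rewrite subr_eq [y + x]addrC.
Qed.

Lemma deltaMn x k : delta (x *+ k) = delta x ^+ k.
Proof. by elim: k => [|k IH]; rewrite ?mulr0n // mulrS deltaD IH exprS. Qed.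

Definition aug u : int := \sum_x gcoef u x.

Lemma aug_add u v : aug (u + v) = aug u + aug v.
Proof. by rewrite /aug -big_split; apply: eq_bigr => x _; rewrite gcoefD. Qed.

Lemma aug_mul u v : aug (u * v) = aug u * aug v.
Proof.
rewrite /aug; under eq_bigr do rewrite gcoefM.
rewrite exchange_big mulr_suml /=; apply: eq_bigr => y _.
by rewrite -mulr_sumr [in RHS](reindex_inj (addIr (- y))).
Qed.

Lemma aug_delta x : aug (delta x) = 1.
Proof.
rewrite /aug (bigD1 x) //= gcoef_delta eqxx big1 ?addr0 // => y /negbTE yx.
by rewrite gcoef_delta yx.
Qed.

(* The element of Z[G] commonly written S^(k); [dil 1 S] is S itself. *)
Definition dil k (S : {set G}) : gring G := \sum_(s in S) delta (s *+ k).

Lemma gcoef_dil k S x : gcoef (dil k S) x = #|[set s in S | s *+ k == x]|%:Z.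
Proof.
rewrite gcoef_sum -sum1_card -natz natr_sum [RHS]big_mkcond [LHS]big_mkcond /=.
by apply: eq_bigr => s _; rewrite gcoef_delta inE eq_sym; case: ifP => //= _; case: eqP.
Qed.

Lemma gcoef_ind S x : gcoef (dil 1 S) x = (x \in S)%:R.
Proof.
rewrite gcoef_dil; case: (boolP (x \in S)) => xS.
  rewrite (_ : [set s in S | s *+ 1 == x]%SET = [set x]%SET) ?cards1 //.
  by apply/setP => s; rewrite !inE mulr1n; case: eqP => [->|]; rewrite ?xS ?andbF.
rewrite (_ : [set s in S | s *+ 1 == x]%SET = finset.set0) ?cards0 //.
by apply/setP => s; rewrite !inE mulr1n; case: eqP => [->|]; rewrite ?(negbTE xS) ?andbF.
Qed.

Lemma aug_dil k S : aug (dil k S) = #|S|%:Z.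
Proof.
have a0 : aug 0 = 0 by rewrite /aug big1 // => x _; rewrite gcoef0.
rewrite /dil (big_morph _ aug_add a0) (eq_bigr (fun=> 1)) => [|x _]; last first.
  exact: aug_delta.
by rewrite sumr_const natz.
Qed.

Lemma gcoef_dil_ge0 k S x : 0 <= gcoef (dil k S) x.
Proof. by rewrite gcoef_dil. Qed.

Lemma gcoefM_ge0 u v : (forall x, 0 <= gcoef u x) -> (forall x, 0 <= gcoef v x) ->
  forall x, 0 <= gcoef (u * v) x.
Proof. by move=> u0 v0 x; rewrite gcoefM sumr_ge0 // => y _; rewrite mulr_ge0. Qed.

Lemma aug1 : aug 1 = 1. Proof. exact: aug_delta. Qed.

Lemma augMn u k : aug (u *+ k) = aug u *+ k.
Proof.
elim: k => [|k IH]; last by rewrite !mulrS aug_add IH.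
by rewrite /aug big1 // => x _; rewrite gcoef0.
Qed.

Lemma gcoefM_delta u x y : gcoef (u * delta y) x = gcoef u (x - y).
Proof.
rewrite mulrC gcoefM (bigD1 y) //= gcoef_delta eqxx mul1r big1 ?addr0 //.
by move=> z /negbTE zy; rewrite gcoef_delta zy mul0r.
Qed.

Lemma gcoef_sqr_ind S x :
  gcoef (dil 1 S ^+ 2) x = #|[set y in S | x - y \in S]|%:Z.
Proof.
rewrite expr2 gcoefM -sum1_card -natz natr_sum [RHS]big_mkcond /=.
by apply: eq_bigr => y _; rewrite !gcoef_ind inE; case: (y \in S); case: (_ \in S).
Qed.

Definition symm (S : {set G}) := forall x, (- x \in S) = (x \in S).

(** The coefficient at 0 of a product pairs s with -s. A sum over a symmetric S thus becomes one
    coefficient of a product, where A B = H - 1 can be used. *)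
Lemma sum_gcoef u S : symm S -> \sum_(s in S) gcoef u s = gcoef (u * dil 1 S) 0.
Proof.
move=> sS; rewrite gcoefM big_mkcond /=; apply: eq_bigr => x _.
by rewrite sub0r gcoef_ind sS; case: (x \in S); rewrite ?mulr1 ?mulr0.
Qed.

End GroupRing.

(** * Squares and cubes of sums modulo 2 and 3 *)

(** Cross terms occur twice (three times for cubes); the witness z keeps the congruence as an
    equation in R. *)
Lemma sqr_sum_mod2 (R : comNzRingType) I (r : seq I) (P : pred I) (F : I -> R) :
  exists z, (\sum_(i <- r | P i) F i) ^+ 2 = \sum_(i <- r | P i) F i ^+ 2 + z *+ 2.
Proof.
elim/big_ind2: _ => [|x2 x1 y2 y1 [z1 E1] [z2 E2]|i _].
- by exists 0; ring.
- by exists (z1 + z2 + x1 * y1); rewrite sqrrD E1 E2; ring.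
- by exists 0; ring.
Qed.

Lemma cube_sum_mod3 (R : comNzRingType) I (r : seq I) (P : pred I) (F : I -> R) :
  exists z, (\sum_(i <- r | P i) F i) ^+ 3 = \sum_(i <- r | P i) F i ^+ 3 + z *+ 3.
Proof.
elim/big_ind2: _ => [|x2 x1 y2 y1 [z1 E1] [z2 E2]|i _].
- by exists 0; ring.
- exists (z1 + z2 + x1 ^+ 2 * y1 + x1 * y1 ^+ 2).
  have -> : (x1 + y1) ^+ 3 =
      x1 ^+ 3 + y1 ^+ 3 + (x1 ^+ 2 * y1 + x1 * y1 ^+ 2) *+ 3 by ring.
  by rewrite E1 E2; ring.
- by exists 0; ring.
Qed.

Lemma dil_sqr (G : finZmodType) (S : {set G}) :
  exists z, dil 1 S ^+ 2 = dil 2 S + z *+ 2.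
Proof.
have [z E] := sqr_sum_mod2 (index_enum G) (mem S) (@delta G).
exists z; rewrite /dil (eq_bigr (@delta G)) => [|x _]; last by rewrite mulr1n.
by rewrite E; congr (_ + _); apply: eq_bigr => x _; rewrite deltaMn.
Qed.

Lemma dil_cube (G : finZmodType) (S : {set G}) :
  exists z, dil 1 S ^+ 3 = dil 3 S + z *+ 3.
Proof.
have [z E] := cube_sum_mod3 (index_enum G) (mem S) (@delta G).
exists z; rewrite /dil (eq_bigr (@delta G)) => [|x _]; last by rewrite mulr1n.
by rewrite E; congr (_ + _); apply: eq_bigr => x _; rewrite deltaMn.
Qed.

(** * Integer sums with termwise lower bounds *)

Lemma sum_ge_card (T : finType) (S : {set T}) (f : T -> int) (m : nat) :
  (forall x, x \in S -> m%:Z <= f x) -> (m * #|S|)%N%:Z <= \sum_(x in S) f x.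
Proof.
move=> fm; rewrite mulnC -sum_nat_const -natz natr_sum.
by apply: ler_sum => x xS; rewrite natz fm.
Qed.

Lemma eq1_of_sum_le (T : finType) (S : {set T}) (f : T -> int) :
  \sum_(x in S) f x <= #|S|%:Z -> (forall x, x \in S -> 1 <= f x) ->
  forall x, x \in S -> f x = 1.
Proof.
move=> fS f1 x xS; apply/eqP; rewrite eq_le f1 // andbT.
have Sx : forall y, y \in S :\ x -> 1 <= f y by move=> y /setD1P[_]; exact: f1.
have := sum_ge_card Sx; rewrite mul1n; have := cardsD1 x S; rewrite xS.
by move: fS; rewrite (big_setD1 x xS) /=; set R := \sum_(y in _) _; lia.
Qed.

(** * The relations between A and B in the subgroup H of odd order *)

Section FactorPair.
Variables (G : finZmodType) (H A B : {set G}) (n a b : nat).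
Local Notation h := (dil 1 H).
Local Notation u := (dil 1 A).
Local Notation v := (dil 1 B).
Hypotheses (H0 : 0 \in H) (HB : forall x y, x \in H -> y \in H -> x - y \in H).
Hypotheses (cardH : #|H| = (n ^ 2 + n + 1)%N)
  (torsH : forall x, x \in H -> x *+ (n ^ 2 + n + 1) = 0).
Hypotheses (cardA : #|A| = a) (cardB : #|B| = b).
Hypotheses (AH : A \subset H) (BH : B \subset H) (sA : symm A) (sB : symm B)
  (A0 : 0 \in A).
Hypothesis mulAB : u * v = h - 1.
Hypothesis sqrAB : u ^+ 2 + v ^+ 2 + dil 2 A + dil 2 B = h *+ 2 + n.*2%:R.

Let HN x : x \in H -> - x \in H.
Proof. by move=> xH; rewrite -sub0r HB. Qed.

Let HD x y : x \in H -> y \in H -> x + y \in H.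
Proof. by move=> xH yH; rewrite -[y]opprK HB // HN. Qed.

Let HMn x k : x \in H -> x *+ k \in H.
Proof. by move=> xH; elim: k => [|k IH]; rewrite ?mulr0n // mulrS HD. Qed.

Let inBH x : x \in B -> x \in H. Proof. exact: (fintype.subsetP BH). Qed.

Lemma delta_subgroup x : x \in H -> delta x * h = h.
Proof.
move=> xH; apply: gringP => y; rewrite gcoefM (bigD1 x) //= gcoef_delta eqxx.
rewrite mul1r big1 ?addr0 => [|t /negbTE tx]; last by rewrite gcoef_delta tx mul0r.
rewrite !gcoef_ind; congr (nat_of_bool _)%:R; apply/idP/idP => yH; last exact: HB.
by rewrite -(subrK x y) HD.
Qed.

Lemma dil_subgroup k (S : {set G}) : S \subset H -> dil k S * h = h *+ #|S|.
Proof.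
move=> /fintype.subsetP SH; rewrite mulr_suml (eq_bigr (fun=> h)) ?sumr_const // => x xS.
by rewrite delta_subgroup // HMn // SH.
Qed.

Lemma double_eq0 x : x \in H -> x *+ 2 = 0 -> x = 0.
Proof.
move=> xH x2; have := torsH xH.
have -> : (n ^ 2 + n + 1 = 2 * ((n ^ 2 + n) %/ 2) + 1)%N.
  by rewrite mulnC divnK // -mulnn -mulnSr dvdn2 oddM /=; case: (odd n).
by rewrite mulrnDr mulrnA x2 mul0rn add0r.
Qed.

(** Multiplication by k is injective on H, so each x is hit at most once. *)
Lemma gcoef_dil_le1 k (S : {set G}) x :
    (forall y, y \in H -> y *+ k = 0 -> y = 0) -> S \subset H ->
  gcoef (dil k S) x <= 1.
Proof.
move=> k0 /fintype.subsetP SH; rewrite gcoef_dil lez_nat; apply/card_le1P => s.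
rewrite inE => /andP[sS /eqP s2] t; rewrite !inE.
apply/andP/eqP => [[tS /eqP t2]|->]; last by rewrite s2.
apply/eqP; rewrite -subr_eq0; apply/eqP/k0; first by rewrite HB ?SH.
by rewrite mulrnBl t2 s2 subrr.
Qed.

Lemma gcoef_dil2_0 (S : {set G}) : S \subset H -> gcoef (dil 2 S) 0 = (0 \in S)%:R.
Proof.
move=> /fintype.subsetP SH; rewrite gcoef_dil -gcoef_ind gcoef_dil.
congr (#|pred_of_set _|%:Z).
apply/setP => s; rewrite !inE mulr1n; case: (boolP (s \in S)) => //= sS.
by apply/eqP/eqP => [/double_eq0->|->] //; rewrite ?mul0rn // SH.
Qed.

(** At 0 the coefficient of H - 1 vanishes, while by symmetry that of A B counts the common elements
    of A and B. *)
Lemma disjAB x : x \in A -> x \notin B.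
Proof.
move=> xA; have /eqP := sum_gcoef v sA.
rewrite mulrC mulAB gcoefD gcoefN gcoef1 gcoef_ind H0 eqxx subrr.
rewrite psumr_eq0 => [|y _]; last exact: gcoef_dil_ge0.
by move=> /allP /(_ x (mem_index_enum _)); rewrite xA gcoef_ind; case: (x \in B).
Qed.

Lemma B0 : 0 \notin B. Proof. exact: disjAB. Qed.

Lemma ABH : A :|: B \subset H.
Proof. by rewrite finset.subUset AH BH. Qed.

Lemma dil2U : dil 2 A + dil 2 B = dil 2 (A :|: B).
Proof.
rewrite /dil -bigU /=; last first.
  rewrite disjoint_subset.
  by apply/fintype.subsetP => x xA; rewrite inE; exact: disjAB.
by apply: eq_bigl => x; rewrite !inE.
Qed.

(** Augmentation gives a b = n^2 + n and a^2 + b^2 + a + b = 2n^2 + 4n + 2, so s = a + b satisfies s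
    (s + 1) = (2n + 1)(2n + 2). *)
Lemma cardAB : (a * b = n ^ 2 + n)%N /\ (a + b = n.*2.+1)%N.
Proof.
have := congr1 (@aug G) mulAB; have := congr1 (@aug G) sqrAB.
have -> : h - 1 = h + 1 *- 1 by rewrite mulr1n.
rewrite !aug_add expr2 expr2 !aug_mul !augMn !aug_dil aug1.
have -> : aug (1 *- 1 : gring G) = -1.
  have := aug_add (1 *- 1) (1 : gring G); rewrite mulr1n addNr aug1.
  by rewrite /aug big1 => [|x _]; rewrite ?gcoef0 //; lia.
rewrite cardA cardB cardH => Esq Emul; split; nia.
Qed.

Lemma cardAB_cases : (a = n /\ b = n.+1) \/ (a = n.+1 /\ b = n).
Proof. by have [] := cardAB; nia. Qed.

(** By symmetry |A| is the coefficient of A^2 at 0; modulo 2 it is that of A_2, which is 1 since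
    only 0 doubles to 0 in H. *)
Lemma oddA : odd a.
Proof.
have [z E] := dil_sqr A; have := congr1 ((@gcoef G)^~ 0) E.
rewrite gcoefD gcoefMn gcoef_dil2_0 // A0 expr2 -sum_gcoef //.
rewrite (eq_bigr (fun=> 1)) => [|x xA]; last by rewrite gcoef_ind xA.
by rewrite sumr_const cardA; lia.
Qed.

Lemma evenB : ~~ odd b.
Proof.
have [z E] := dil_sqr B; have := congr1 ((@gcoef G)^~ 0) E.
rewrite gcoefD gcoefMn gcoef_dil2_0 // (negbTE B0) expr2 -sum_gcoef //.
rewrite (eq_bigr (fun=> 1)) => [|x xA]; last by rewrite gcoef_ind xA.
by rewrite sumr_const cardB; lia.
Qed.

(** Modulo 2, A_2 B = A (A B) = a H - A with a odd, so the coefficients on H off A are odd, hence at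
    least 1. Their sum is at most a b - (a - 1) = |H| - a, which leaves exactly 1 for each. *)
Lemma gcoef_dil2A_mul_B x : x \in H -> x \notin A -> gcoef (dil 2 A * v) x = 1.
Proof.
have [z E] := dil_sqr A.
have Ea : dil 2 A * v = h *+ a - u - (z * v) *+ 2.
  rewrite -cardA -(dil_subgroup 1 AH).
  have -> : dil 2 A = u ^+ 2 - z *+ 2 by rewrite E; ring.
  have -> : (u ^+ 2 - z *+ 2) * v = u * (u * v) - (z * v) *+ 2 by ring.
  by rewrite mulAB; ring.
have odda y : y \in H -> y \notin A -> 1 <= gcoef (dil 2 A * v) y.
  move=> yH yA; have := gcoefM_ge0 (gcoef_dil_ge0 2 A) (gcoef_dil_ge0 1 B) y.
  rewrite Ea !(gcoefD, gcoefN, gcoefMn) !gcoef_ind yH (negbTE yA).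
  by have := oddA; lia.
(* This is the coefficient of A_2 (H - 1) at 0. *)
have sumA : \sum_(y in A) gcoef (dil 2 A * v) y = a%:Z - 1.
  rewrite sum_gcoef // -mulrA [v * u]mulrC mulAB mulrBr mulr1 dil_subgroup //.
  by rewrite gcoefD gcoefN gcoefMn gcoef_ind H0 cardA gcoef_dil2_0 // A0; lia.
have sumH : \sum_(y in H :\: A) gcoef (dil 2 A * v) y <= #|H :\: A|%:Z.
  have := aug_mul (dil 2 A) v; rewrite !aug_dil /aug (bigID (mem A)) /= sumA.
  rewrite (bigID (mem H)) /= => Eaug.
  have : 0 <= \sum_(i | (i \notin A) && (i \notin H)) gcoef (dil 2 A * v) i.
    by apply: sumr_ge0 => y _; apply: gcoefM_ge0 => ?; exact: gcoef_dil_ge0.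
  have -> : \sum_(i in H :\: A) gcoef (dil 2 A * v) i =
      \sum_(i | (i \notin A) && (i \in H)) gcoef (dil 2 A * v) i.
    by apply: eq_bigl => y; rewrite inE.
  have := cardsID A H; rewrite (finset.setIidPr AH) cardA cardH.
  have [] := cardAB; move: Eaug; rewrite cardA cardB.
  set s : int := \sum_(i | _ && (i \in H)) _.
  set t : int := \sum_(i | _ && (i \notin H)) _.
  set d := #|_ :\: _|.
  by nia.
move=> xH xA; apply: (eq1_of_sum_le sumH); rewrite ?inE ?xA // => y /setDP[].
exact: odda.
Qed.

(** Modulo 2, A B_2 = (A B) B = b H - B with b even, so the coefficients on B are odd; their sum,
    the coefficient of B_2 (H - 1) at 0, is b. *)
Lemma gcoef_A_mul_dil2B x : x \in B -> gcoef (u * dil 2 B) x = 1.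
Proof.
have [z E] := dil_sqr B.
have Eb : u * dil 2 B = h *+ b - v - (z * u) *+ 2.
  rewrite -cardB -(dil_subgroup 1 BH).
  have -> : dil 2 B = v ^+ 2 - z *+ 2 by rewrite E; ring.
  have -> : u * (v ^+ 2 - z *+ 2) = (u * v) * v - (z * u) *+ 2 by ring.
  by rewrite mulAB; ring.
have oddb y : y \in B -> 1 <= gcoef (u * dil 2 B) y.
  move=> yB; have := gcoefM_ge0 (gcoef_dil_ge0 1 A) (gcoef_dil_ge0 2 B) y.
  rewrite Eb !(gcoefD, gcoefN, gcoefMn) !gcoef_ind yB (inBH yB).
  by have := evenB; lia.
have sumB : \sum_(y in B) gcoef (u * dil 2 B) y = b%:Z.
  rewrite sum_gcoef // mulrAC mulAB mulrC mulrBr mulr1 dil_subgroup //.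
  by rewrite gcoefD gcoefN gcoefMn gcoef_ind H0 cardB gcoef_dil2_0 // (negbTE B0); lia.
by move=> xB; apply: (eq1_of_sum_le _ oddb); rewrite ?sumB ?cardB.
Qed.

Lemma gcoef_dil3_0 : 1 <= gcoef (dil 3 A) 0.
Proof.
rewrite gcoef_dil lez_nat; apply/card_gt0P; exists 0.
by rewrite inE A0 mul0rn eqxx.
Qed.

(** The total is a, and at least 1 of it sits at 0, outside B. *)
Lemma sum_gcoef_dil3 : \sum_(x in B) gcoef (dil 3 A) x <= a%:Z - 1.
Proof.
have := aug_dil 3 A; rewrite cardA /aug (bigID (mem B)) /=.
rewrite [X in _ + X](bigD1 0) ?B0 //=; have := gcoef_dil3_0.
have : 0 <= \sum_(i | (i \notin B) && (i != 0)) gcoef (dil 3 A) i.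
  by apply: sumr_ge0 => y _; exact: gcoef_dil_ge0.
set s : int := \sum_(i in B) _.
set t : int := \sum_(i | (i \notin B) && _) _; set c : int := gcoef _ 0.
lia.
Qed.

Lemma sum_mul_dil2 : \sum_(x in B) gcoef (u * dil 2 A) x = a%:Z - 1.
Proof.
rewrite sum_gcoef // mulrAC mulAB mulrC mulrBr mulr1 dil_subgroup // cardA.
by rewrite gcoefD gcoefN gcoefMn gcoef_ind H0 gcoef_dil2_0 // A0; lia.
Qed.

(** The quadratic relation times A, with A B^2 = (H - 1) B and A^3 = A_3 + 3z. *)
Lemma mul_dil2E : exists z, u * (dil 2 A + dil 2 B) =
  u * h *+ 2 - v * h + v + u *+ n.*2 - dil 3 A - z *+ 3.
Proof.
have [z E] := dil_cube A; exists z.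
have -> : dil 3 A = u ^+ 3 - z *+ 3 by rewrite E; ring.
have -> : dil 2 A + dil 2 B = h *+ 2 + n.*2%:R - u ^+ 2 - v ^+ 2.
  by rewrite -sqrAB; ring.
have -> : u * (h *+ 2 + n.*2%:R - u ^+ 2 - v ^+ 2) =
  u * h *+ 2 + u *+ n.*2 - u ^+ 3 - (u * v) * v by ring.
by rewrite mulAB; ring.
Qed.

(** On B the coefficient 1 of A B_2 cancels that of the summand B. *)
Lemma mul_dil2_mod3 x : x \in B -> exists k : int,
  gcoef (u * dil 2 A) x + gcoef (dil 3 A) x = a%:Z *+ 2 - b%:Z + k *+ 3.
Proof.
move=> xB; have [z E] := mul_dil2E; exists (- gcoef z x).
have := congr1 ((@gcoef G)^~ x) E.
rewrite mulrDr !dil_subgroup // !(gcoefD, gcoefN, gcoefMn) gcoef_A_mul_dil2B //.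
rewrite !gcoef_ind xB (inBH xB) cardA cardB.
have /negbTE -> : x \notin A by apply/negP => /disjAB; rewrite xB.
lia.
Qed.

Lemma factor_pair_3dvd : (0 < n)%N -> (3 %| n)%N -> False.
Proof.
move=> n0 n3.
(* Both values of 2a - b, namely n - 1 and n + 2, are 2 modulo 3. *)
have ge2 x : x \in B -> 2 <= gcoef (u * dil 2 A) x + gcoef (dil 3 A) x.
  move=> xB; have [k] := mul_dil2_mod3 xB.
  have := gcoefM_ge0 (gcoef_dil_ge0 1 A) (gcoef_dil_ge0 2 A) x.
  have := gcoef_dil_ge0 3 A x.
  by have := cardAB_cases; lia.
have := sum_ge_card ge2; rewrite cardB big_split /= sum_mul_dil2.
have := sum_gcoef_dil3; set s : int := \sum_(i in B) _ => s1 s2.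
(* Summing over B gives 2b <= 2(a - 1), which excludes a = n and leaves equality throughout. *)
have [a_n b_n] : a = n.+1 /\ b = n by have := cardAB_cases; lia.
have sE : s = n%:Z by lia.
have thrice0 y : y \in H -> y *+ 3 = 0 -> y = 0.
  move=> yH y3; have := torsH yH.
  have -> : (n ^ 2 + n + 1 = 3 * (n %/ 3 * n.+1) + 1)%N by nia.
  by rewrite mulrnDr mulrnA y3 mul0rn add0r.
(* The coefficients are at most 1 and sum to |B|; passing to 2 - c turns the upper bound into the
   required lower bound. *)
have A3B x : x \in B -> gcoef (dil 3 A) x = 1.
  move=> xB; suff : 2 - gcoef (dil 3 A) x = 1 by lia.
  apply: (@eq1_of_sum_le _ B (fun y => 2 - gcoef (dil 3 A) y)) => // [|y _].
    rewrite sumrB -/s sumr_const cardB sE b_n; lia.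
  by have := gcoef_dil_le1 y thrice0 AH; lia.
(* A_3 - B - 1 has nonnegative coefficients and augmentation a - (b + 1) = 0. *)
have A3E : dil 3 A = v + 1.
  apply: gringP => x; apply/eqP; rewrite -subr_eq0 -gcoefN -gcoefD; apply/eqP.
  set w := dil 3 A - (v + 1).
  have w0 y : 0 <= gcoef w y.
    rewrite /w !(gcoefD, gcoefN) gcoef_ind gcoef1.
    case: (boolP (y \in B)) => yB; first rewrite A3B //.
      by case: eqP => // y0; rewrite y0 (negbTE B0) in yB.
    case: eqP => [->|_]; last by have := gcoef_dil_ge0 3 A y; lia.
    by have := gcoef_dil3_0; lia.
  have /eqP : aug w = 0.
    have := aug_add w (v + 1); rewrite subrK aug_add !aug_dil aug1 cardA cardB.
    by rewrite a_n b_n; lia.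
  rewrite /aug psumr_eq0 // => /allP/(_ x (mem_index_enum _)) /eqP.
  exact.
(* Multiplied by B, the left side becomes (H - 1)(A_2 + B_2), which gives access to A_2 + B_2 on
   B. *)
have [z] := mul_dil2E; rewrite A3E => /(congr1 ( *%R^~ v)).
have -> : u * (dil 2 A + dil 2 B) * v = (u * v) * (dil 2 A + dil 2 B) by ring.
have -> : (u * h *+ 2 - v * h + v + u *+ n.*2 - (v + 1) - z *+ 3) * v =
  (u * v) * h *+ 2 - v * (v * h) + (u * v) *+ n.*2 - v - (z * v) *+ 3 by ring.
rewrite mulAB !mulrBl !mul1r [h * _]mulrC mulrDl !dil_subgroup // !mulrnAr.
rewrite !dil_subgroup // cardA cardB cardH.
have /card_gt0P [x xB] : (0 < #|B|)%N by rewrite cardB b_n.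
move=> /(congr1 ((@gcoef G)^~ x)); rewrite !(gcoefD, gcoefN, gcoefMn).
rewrite -gcoefD dil2U !gcoef_ind gcoef1 xB (inBH xB).
have /negbTE -> : x != 0 by apply: contraNneq B0 => <-.
(* The coefficient of A_2 + B_2 at x lies between 0 and 1, yet it is 2 - 2n - n^2, that is 2, modulo
   3. *)
have := gcoef_dil_le1 x double_eq0 ABH; have := gcoef_dil_ge0 2 (A :|: B) x.
set y := gcoef _ x; set w := gcoef _ x.
by rewrite a_n b_n; nia.
Qed.

Lemma factor_pair_4mod6 : (n %% 6 = 4)%N -> False.
Proof.
move=> n4.
have [a_n b_n] : a = n.+1 /\ b = n.
  by case: cardAB_cases => -[a_n b_n] //; have := oddA; lia.
have [z E] := dil_cube B.
(* The quadratic relation times B, with B A^2 = (H - 1) A. *)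
have D : v * dil 2 B =
    v * h *+ 2 + v *+ n.*2 - u * h + u - dil 3 B - dil 2 A * v - z *+ 3.
  have -> : dil 3 B = v ^+ 3 - z *+ 3 by rewrite E; ring.
  have -> : dil 2 B = h *+ 2 + n.*2%:R - u ^+ 2 - v ^+ 2 - dil 2 A.
    by rewrite -sqrAB; ring.
  have -> : v * (h *+ 2 + n.*2%:R - u ^+ 2 - v ^+ 2 - dil 2 A) =
    v * h *+ 2 + v *+ n.*2 - (u * v) * u - v ^+ 3 - dil 2 A * v by ring.
  by rewrite mulAB; ring.
pose f x := gcoef (v * dil 2 B) x + gcoef (dil 3 B) x.
have f0 x : 0 <= f x.
  by rewrite addr_ge0 ?gcoef_dil_ge0 // gcoefM_ge0 // => y; exact: gcoef_dil_ge0.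
(* Here [D] gives 2n - (n + 1) - 1 = n - 2, which is 2 modulo 3. *)
have f2 x : x \in H :\: (A :|: B) -> 2 <= f x.
  rewrite !inE negb_or => /andP[/andP[xA xB] xH]; have := f0 x.
  rewrite /f D !dil_subgroup // !(gcoefD, gcoefN, gcoefMn) gcoef_dil2A_mul_B //.
  rewrite !gcoef_ind xH (negbTE xA) (negbTE xB) cardA cardB.
  lia.
have sumf : \sum_x f x = b%:Z * b%:Z + b%:Z.
  by rewrite big_split /= -/(aug _) -/(aug _) aug_mul !aug_dil cardB.
have sumA : b%:Z <= \sum_(x in A) f x.
  rewrite big_split /= sum_gcoef // mulrAC [v * u]mulrC mulAB mulrC mulrBr mulr1.
  rewrite dil_subgroup // gcoefD gcoefN gcoefMn gcoef_ind H0 gcoef_dil2_0 //.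
  rewrite (negbTE B0) cardB.
  have : 0 <= \sum_(x in A) gcoef (dil 3 B) x.
    by apply: sumr_ge0 => x _; exact: gcoef_dil_ge0.
  by set s : int := \sum_(x in A) _; lia.
(* H off A and B has n^2 - n elements, so the total n^2 + n of [f] is at least n + 2(n^2 - n),
   impossible for n >= 4. *)
have := sum_ge_card f2; have := cardsID (A :|: B) H.
rewrite (finset.setIidPr ABH) cardH cardsU cardA cardB.
have -> : A :&: B = finset.set0.
  by apply/setP => x; rewrite !inE; apply/negP => /andP[/disjAB/negbTE->].
rewrite cards0.
move: sumf; rewrite (bigID (mem A)) /=.
rewrite [X in _ + X](bigID (mem (H :\: (A :|: B)))) /=.
have -> : \sum_(i | (i \notin A) && (i \in H :\: (A :|: B))) f i =
    \sum_(i in H :\: (A :|: B)) f i.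
  by apply: eq_bigl => x; rewrite !inE; case: (x \in A); rewrite ?andbF.
have : 0 <= \sum_(i | (i \notin A) && (i \notin H :\: (A :|: B))) f i.
  by apply: sumr_ge0.
move: sumA; set s : int := \sum_(x in A) _; set t : int := \sum_(i in _) _.
set r : int := \sum_(i | _) _; set c := #|_|.
rewrite a_n b_n => s0 r0 Es Ec tc.
have n2 : (n ^ 2 = n * n)%N by rewrite mulnn.
have n4' : (4 <= n)%N by lia.
have t1 : t <= n%:Z * n%:Z by lia.
have c1 : c = (n * n - n)%N by lia.
by nia.
Qed.

End FactorPair.

(** * Splitting T along the involution g *)

Section Split.
Variables (G : finZmodType) (T : {set G}) (n : nat).
Hypotheses (T0 : 0 \in T) (sT : symm T) (cardT : #|T| = n.*2.+1).
Hypothesis T_double : forall t, t \in T -> t + t = 0 -> t = 0.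
Hypothesis T_sum : forall t1 t2 t3 t4, t1 \in T -> t2 \in T -> t3 \in T ->
  t4 \in T -> t1 + t2 = t3 + t4 -> [\/ t1 + t2 = 0, t1 = t3 | t1 = t4].
Variable g : G.
Hypothesis T_cover : forall x,
  reflect (exists t1 t2, [/\ t1 \in T, t2 \in T & x = t1 + t2]) (x != g).

Let e := delta g.

Lemma missing_neq0 : g != 0.
Proof. by rewrite eq_sym; apply/T_cover; exists 0, 0; rewrite addr0. Qed.

(** T + T is symmetric, so the only element it misses is its own opposite. *)
Lemma missing_double : g + g = 0.
Proof.
suff : - g = g by move=> {1}<-; rewrite addNr.
apply/eqP; apply: contraT => /T_cover [t1 [t2 [t1T t2T gE]]].
have /negP[] : ~~ (g != g) by rewrite negbK.
by apply/T_cover; exists (- t1), (- t2); rewrite !sT -opprD -gE opprK.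
Qed.

(** If x = t1 + t2 and 2x = 0, then t1 + t2 = (-t1) + (-t2), and sums of two elements of T are
    essentially unique. *)
Lemma double_eq0_missing x : x + x = 0 -> x = 0 \/ x = g.
Proof.
move=> x2; case: (eqVneq x g) => [|/T_cover [t1 [t2 [t1T t2T xE]]]]; [by right|left].
have : t1 + t2 = - t1 + - t2 by rewrite -opprD -xE; apply/eqP; rewrite -addr_eq0 x2.
have [Nt1 Nt2] : - t1 \in T /\ - t2 \in T by rewrite !sT.
case/(T_sum t1T t2T Nt1 Nt2) => [|t1E|t1E]; first by rewrite xE.
- have t10 : t1 = 0 by apply: T_double => //; rewrite {1}t1E addNr.
  by move: xE x2; rewrite t10 add0r => ->; exact: T_double.
- by rewrite xE t1E addNr.
Qed.

(** For x other than 0 and g, the two orders of x = t1 + t2 count 2 in T^2; if t1 = t2 they count 1,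
    and T_2 supplies the other. At 0 the count is (2n + 1) + 1, at g it is 0. *)
Lemma dil_sqrE : dil 1 T ^+ 2 + dil 2 T =
  dil 1 [set: G]%SET *+ 2 - e *+ 2 + n.*2%:R.
Proof.
apply: gringP => x.
rewrite !(gcoefD, gcoefN, gcoefMn) gcoef_delta gcoef1 gcoef_ind finset.in_setT.
rewrite gcoef_sqr_ind gcoef_dil.
have [->|x0] := eqVneq x 0.
  rewrite [0 == g]eq_sym (negbTE missing_neq0).
  have -> : [set y in T | 0 - y \in T]%SET = T.
    by apply/setP => y; rewrite inE sub0r sT andbb.
  have -> : [set s in T | s *+ 2 == 0]%SET = [set 0]%SET.
    apply/setP => y; rewrite !inE; apply/andP/eqP => [[yT /eqP]|->]; last first.
      by rewrite mul0rn.
    by rewrite mulr2n => /T_double->.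
  by rewrite cards1 cardT; lia.
have [->|/T_cover[t1 [t2 [t1T t2T xE]]]] := eqVneq x g.
  have nT y z : y \in T -> z \in T -> (g == y + z) = false.
    move=> yT zT; apply/negbTE; apply/negP => /eqP gE; have /negP[] : ~~ (g != g).
      by rewrite negbK.
    by apply/T_cover; exists y, z.
  have -> : [set y in T | g - y \in T]%SET = finset.set0.
    apply/setP => y; rewrite !inE; apply/negP => /andP[yT zT].
    by have := nT _ _ zT yT; rewrite subrK eqxx.
  have -> : [set s in T | s *+ 2 == g]%SET = finset.set0.
    apply/setP => y; rewrite !inE; apply/negP => /andP[yT /eqP gE].
    by have := nT _ _ yT yT; rewrite -gE mulr2n eqxx.
  by rewrite cards0; lia.
have tE y : y \in T -> x - y \in T -> y = t1 \/ y = t2.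
  move=> yT zT; have : y + (x - y) = t1 + t2 by rewrite addrC subrK.
  case/(T_sum yT zT t1T t2T) => [|->|->]; [|by left|by right].
  by rewrite addrC subrK => /eqP; rewrite (negbTE x0).
have -> : [set y in T | x - y \in T]%SET = [set t1; t2]%SET.
  apply/setP => y; rewrite !inE; apply/andP/orP => [[yT zT]|].
    by case: (tE y yT zT) => ->; rewrite eqxx; [left|right].
  by case=> /eqP->; rewrite xE ?addrK // addrC addKr.
have -> : [set s in T | s *+ 2 == x]%SET = if t1 == t2 then [set t1]%SET else finset.set0.
  apply/setP => y; case: eqVneq => [t12|/eqP t12]; rewrite !inE; last first.
    apply/negP => /andP[yT /eqP yE].
    have : y + y = t1 + t2 by rewrite -xE -yE mulr2n.
    case/(T_sum yT yT t1T t2T) => [|yt|yt].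
    - by rewrite -mulr2n yE => /eqP; rewrite (negbTE x0).
    - by apply: t12; apply: (addrI t1); rewrite -xE -yE yt mulr2n.
    - by apply: t12; apply: (addIr t2); rewrite -xE -yE yt mulr2n.
  apply/andP/eqP => [[yT /eqP yE]|->]; last by rewrite t1T mulr2n {2}t12 xE eqxx.
  by case: (tE y) => //; [rewrite -yE mulr2n addrK|rewrite t12].
by rewrite cards2; case: eqP => _; rewrite ?cards1 ?cards0; lia.
Qed.

Let N := (n ^ 2 + n + 1)%N.

Lemma cardG : #|G| = N.*2.
Proof.
have := congr1 (@aug G) dil_sqrE.
have augN (w : gring G) : aug (- w) = - aug w.
  by apply/eqP; rewrite -addr_eq0 -aug_add addNr /aug big1 // => x _; rewrite gcoef0.
rewrite !(aug_add, augN, augMn, aug_mul, aug_delta, aug1) !aug_dil cardT cardsT.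
set c := #|_|; rewrite /N; nia.
Qed.

Lemma oddN : odd N.
Proof. by rewrite /N addn1 /= -mulnn -mulnSr oddM /=; case: (odd n). Qed.

Lemma mulN2 (x : G) : x *+ N + x *+ N = 0.
Proof.
(* Adding x permutes G, so comparing sums over all of G gives |G| x = 0. *)
rewrite -mulrnDr addnn -cardG; apply: (addIr (\sum_y y)).
by rewrite add0r [RHS](reindex_inj (addrI x)) big_split sumr_const.
Qed.

Lemma missing_mulN : g *+ N = g.
Proof.
rewrite -(odd_double_half N) oddN mulrnDr -mul2n mulrnA mulr2n.
by rewrite missing_double mul0rn addr0.
Qed.

Definition odd_part := [set x : G | x *+ N == 0]%SET.
Local Notation H := odd_part.

Lemma odd_partB x y : x \in H -> y \in H -> x - y \in H.
Proof. by rewrite !inE mulrnBl => /eqP-> /eqP->; rewrite subrr. Qed.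

Lemma odd_partD x y : x \in H -> y \in H -> x + y \in H.
Proof. by rewrite !inE mulrnDl => /eqP-> /eqP->; rewrite addr0. Qed.

Lemma odd_partMn x k : x \in H -> x *+ k \in H.
Proof. by rewrite !inE mulrnAC => /eqP->; rewrite mul0rn. Qed.

Lemma odd_part0 : 0 \in H. Proof. by rewrite inE mul0rn. Qed.

Lemma addgK : involutive (+%R^~ g).
Proof. by move=> x; rewrite -addrA missing_double addr0. Qed.

Lemma subg x : x - g = x + g.
Proof. by apply/eqP; rewrite subr_eq addgK. Qed.

(** N x is killed by 2, so it is 0 or g; as N g = g, adding g exchanges the two cases and G is the
    disjoint union of H and H + g. *)
Lemma odd_part_addg x : (x + g \in H) = (x \notin H).
Proof.
rewrite !inE mulrnDl missing_mulN.
have [->|->] := double_eq0_missing (mulN2 x).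
  by rewrite add0r eqxx (negbTE missing_neq0).
by rewrite missing_double eqxx missing_neq0.
Qed.

(* The A and B of the decomposition T = A + B g. *)
Definition even_half := [set x in H | x \in T]%SET.
Definition odd_half := [set x in H | x + g \in T]%SET.
Local Notation A := even_half.
Local Notation B := odd_half.

Lemma ind_split (S : {set G}) : dil 1 S =
  dil 1 [set x in H | x \in S]%SET + dil 1 [set x in H | x + g \in S]%SET * e.
Proof.
apply: gringP => x; rewrite gcoefD gcoefM_delta subg !gcoef_ind.
have -> : (x \in [set x in H | x \in S]%SET) = (x \in H) && (x \in S).
  by rewrite inE.
have -> : (x + g \in [set x in H | x + g \in S]%SET) = (x \notin H) && (x \in S).
  by rewrite inE odd_part_addg addgK.
by case: (x \in H); case: (x \in S).
Qed.

(** As 2g = 0, x and x + g have the same double, so no factor [e] appears. *)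
Lemma dil2_split : dil 2 T = dil 2 A + dil 2 B.
Proof.
rewrite /dil (bigID (mem H)) /=; congr (_ + _).
  by apply: eq_bigl => x; rewrite /even_half [RHS]inE andbC.
rewrite [LHS](reindex_inj (addIr g)) /=; apply: eq_big => [x|x _].
  by rewrite odd_part_addg negbK /odd_half [RHS]inE andbC.
by rewrite mulrnDl [g *+ 2]mulr2n missing_double addr0.
Qed.

(** The subring Z[H] of Z[G]. *)
Definition supp (w : gring G) := forall x, x \notin H -> gcoef w x = 0.

Lemma suppD w w' : supp w -> supp w' -> supp (w + w').
Proof. by move=> sw sw' x xH; rewrite gcoefD sw ?sw' ?addr0. Qed.

Lemma suppN w : supp w -> supp (- w).
Proof. by move=> sw x xH; rewrite gcoefN sw ?oppr0. Qed.

Lemma suppMn w k : supp w -> supp (w *+ k).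
Proof. by move=> sw x xH; rewrite gcoefMn sw ?mul0rn. Qed.

Lemma suppM w w' : supp w -> supp w' -> supp (w * w').
Proof.
move=> sw sw' x xH; rewrite gcoefM big1 // => y _.
have [yH|/sw->] := boolP (y \in H); last by rewrite mul0r.
by rewrite sw' ?mulr0 //; apply: contra xH => zH; rewrite -(subrK y x) odd_partD.
Qed.

Lemma supp1 : supp 1.
Proof.
by move=> x xH; rewrite gcoef1; case: eqP xH => // ->; rewrite odd_part0.
Qed.

Lemma supp_dil k (S : {set G}) : S \subset H -> supp (dil k S).
Proof.
move=> /fintype.subsetP SH x xH; rewrite gcoef_dil; apply/eqP.
rewrite eqz_nat cards_eq0; apply/eqP/setP => s; rewrite !inE.
by apply/negP => /andP[sS /eqP sE]; rewrite -sE odd_partMn ?SH in xH.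
Qed.

Lemma supp_split w w' : supp w -> supp w' -> w + w' * e = 0 -> w = 0 /\ w' = 0.
Proof.
move=> sw sw' E; have E' x : gcoef w x + gcoef w' (x + g) = 0.
  by rewrite -subg -gcoefM_delta -gcoefD E gcoef0.
split; apply: gringP => x; rewrite gcoef0.
  have [xH|/sw//] := boolP (x \in H).
  by have := E' x; rewrite sw' ?addr0 // odd_part_addg negbK.
have [xH|/sw'//] := boolP (x \in H).
by have := E' (x + g); rewrite addgK sw ?add0r // odd_part_addg negbK.
Qed.


Lemma even_half_sub : A \subset H.
Proof. by apply/fintype.subsetP => x; rewrite inE => /andP[]. Qed.

Lemma odd_half_sub : B \subset H.
Proof. by apply/fintype.subsetP => x; rewrite inE => /andP[]. Qed.

Lemma odd_partN x : (- x \in H) = (x \in H).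
Proof. by rewrite !inE mulNrn oppr_eq0. Qed.

Lemma even_half_sym : symm A.
Proof. by move=> x; rewrite /even_half inE odd_partN sT [RHS]inE. Qed.

Lemma odd_half_sym : symm B.
Proof.
move=> x; rewrite /odd_half inE odd_partN [RHS]inE.
by rewrite -[X in _ && (X \in T)]opprK opprD opprK sT subg.
Qed.

Lemma even_half0 : 0 \in A. Proof. by rewrite inE odd_part0. Qed.

Lemma sqr_delta_missing : e ^+ 2 = 1.
Proof. by rewrite expr2 -deltaD missing_double. Qed.

Lemma ind_all : dil 1 [set: G]%SET = dil 1 H + dil 1 H * e.
Proof.
rewrite ind_split; congr (dil 1 _ + dil 1 _ * _).
  by apply/setP => x; rewrite !inE andbT.
by apply/setP => x; rewrite !inE andbT.
Qed.

Lemma card_odd_part : #|H| = N.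
Proof.
have := congr1 (@aug G) ind_all.
rewrite aug_add aug_mul aug_delta !aug_dil cardsT cardG.
by set c := #|_|; lia.
Qed.

(** Expanding (A + B e)^2 with e^2 = 1 and comparing the components in Z[H] and Z[H] e gives the
    quadratic relation and 2 A B = 2(H - 1); the latter is halved coefficientwise. *)
Lemma half_mulE : dil 1 A * dil 1 B = dil 1 H - 1 /\
  dil 1 A ^+ 2 + dil 1 B ^+ 2 + dil 2 A + dil 2 B = dil 1 H *+ 2 + n.*2%:R.
Proof.
have sA k : supp (dil k A) by apply: supp_dil; exact: even_half_sub.
have sB k : supp (dil k B) by apply: supp_dil; exact: odd_half_sub.
have sH : supp (dil 1 H) by exact: supp_dil.
have s1 := supp1.
have [] := @supp_split
  (dil 1 A ^+ 2 + dil 1 B ^+ 2 + dil 2 A + dil 2 B - (dil 1 H *+ 2 + n.*2%:R))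
  ((dil 1 A * dil 1 B - (dil 1 H - 1)) *+ 2).
- rewrite !expr2.
  by repeat (apply: suppD || apply: suppN || apply: suppMn || apply: suppM).
- by repeat (apply: suppD || apply: suppN || apply: suppMn || apply: suppM).
- have := dil_sqrE; rewrite ind_all dil2_split [dil 1 T]ind_split => E.
  have -> : (dil 1 A * dil 1 B - (dil 1 H - 1)) *+ 2 * e =
    (dil 1 A + dil 1 B * e) ^+ 2 - dil 1 A ^+ 2 - dil 1 B ^+ 2 * e ^+ 2
      - (dil 1 H - 1) *+ 2 * e by ring.
  rewrite sqr_delta_missing -[(dil 1 A + _) ^+ 2](addrK (dil 2 A + dil 2 B)) E.
  ring.
move=> /subr0_eq-> E; split=> //; apply: subr0_eq; apply: gringP => x.
have /eqP := congr1 ((@gcoef G)^~ x) E.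
by rewrite gcoefMn gcoef0 mulrn_eq0 => /eqP.
Qed.

Lemma no_almost_cover : (0 < n)%N -> (3 %| n)%N || (n %% 6 == 4)%N -> False.
Proof.
move=> n0; have [E1 E2] := half_mulE.
have tors x : x \in H -> x *+ (n ^ 2 + n + 1) = 0 by rewrite inE => /eqP.
case/orP => [n3|/eqP n4].
  exact: (factor_pair_3dvd odd_part0 odd_partB card_odd_part tors erefl erefl
    even_half_sub odd_half_sub even_half_sym odd_half_sym even_half0 E1 E2).
exact: (factor_pair_4mod6 odd_part0 odd_partB card_odd_part tors erefl erefl
  even_half_sub odd_half_sub even_half_sym even_half0 E1 E2).
Qed.

End Split.

(** * The finite quotient of Z^n by a code *)

Lemma finZmod_of_enum (V : zmodType) (s : seq V) : uniq s -> (forall x, x \in s) ->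
  exists (G : finZmodType) (f : {additive V -> G}), bijective f /\ #|G| = size s.
Proof.
move=> us sT.
have K : pcancel (index^~ s) (onth s).
  by move=> x; rewrite onthE (nth_map x) ?index_mem // nth_index.
have E : Finite.axiom s.
  by move=> x; rewrite count_uniq_mem // sT.
pose G : finZmodType := HB.pack V (isFinite.Build V E) (Choice_isCountable.Build V K).
exists G, idfun; split; first by exists idfun.
rewrite cardE; apply/perm_size/uniq_perm; rewrite ?enum_uniq // => x.
by rewrite mem_enum sT.
Qed.

Lemma in_translate n (C : set 'rV[int]_n) x y : translate x C y <-> C (y - x).
Proof.
split; first by move=> [c Cc <-]; rewrite addrC addKr.
by move=> Cyx; exists (y - x) => //; rewrite addrC subrK.
Qed.

Lemma translate_eq n (C : set 'rV[int]_n) x y : linear_lee_code C ->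
  translate x C = translate y C <-> C (x - y).
Proof.
move=> [C0 CB].
have C0' : C 0 by exact: set_mem.
have CB' a b : C a -> C b -> C (a - b).
  by move=> /mem_set Ca /mem_set Cb; apply: set_mem; exact: CB.
split=> [xy|Cxy].
  by apply/in_translate; rewrite -xy; apply/in_translate; rewrite subrr.
apply/seteqP; split=> z /in_translate Cz; apply/in_translate.
  have -> : z - y = (z - x) - (0 - (x - y)) by rewrite sub0r opprK addrA subrK.
  by do 2 apply: (CB') => //.
have -> : z - x = (z - y) - (x - y) by rewrite opprB addrA subrK.
exact: CB'.
Qed.

Lemma finite_quotient n (C : set 'rV[int]_n) :
    linear_lee_code C -> (0 < lattice_index C)%N ->
  exists (G : finZmodType) (p : {additive 'rV[int]_n -> G}),
  [/\ forall q, exists x, p x = q, forall x, p x = 0 <-> C x & #|G| = lattice_index C].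
Proof.
move=> lC iC.
pose I : zmodClosed 'rV[int]_n :=
  HB.pack (fun x => x \in C) (GRing.isZmodClosed.Build _ (fun x => x \in C) lC).
pose Q := ring_quotient.Quotient.quot I.
pose pi : {additive 'rV[int]_n -> Q} := \pi_Q%qT.
have piE x y : pi x = pi y <-> C (x - y).
  have E : (x - y \in C) = (pi x == pi y).
    exact: (ring_quotient.Quotient.idealrBE I x y).
  by split=> [/eqP|/mem_set]; [rewrite -E; exact: set_mem|rewrite E => /eqP].
set cosets := [set translate x C | x in [set: 'rV[int]_n]] in iC *.
(* [fset_set] sends an infinite set to [fset0], so positive index forces finiteness. *)
have fin : finite_set cosets.
  apply: contrapT => inf; move: iC; rewrite /lattice_index -/cosets.
  have -> : fset_set cosets = fset0 by rewrite /fset_set; case: pselect.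
  by rewrite cardfs0.
(* One chosen representative per coset turns the set of cosets into an enumeration of the
   quotient. *)
pose rep k := xget 0 [set x | translate x C = k].
have repK k : cosets k -> translate (rep k) C = k.
  by move=> [x _ xk]; apply: (@xgetPex _ 0 [set x | translate x C = k]); exists x.
have [||G [f [bf cG]]] := @finZmod_of_enum Q [seq pi (rep k) | k <- fset_set cosets].
- rewrite map_inj_in_uniq ?fset_uniq // => k k'.
  rewrite !in_fset_set // !inE => Kk Kk' /piE /translate_eq.
  by rewrite !repK //; exact.
- move=> q; rewrite -[q]reprK; set x := repr q.
  apply/mapP; exists (translate x C); first by rewrite in_fset_set // inE; exists x.
  by apply/piE/translate_eq => //; rewrite repK //; exists x.
exists G, (f \o pi); split.
- move=> q; have [h _ fh] := bf; exists (repr (h q)).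
  by rewrite /= [pi _]reprK fh.
- move=> x; rewrite /= -(raddf0 f); split => [/(bij_inj bf)|Cx].
    by rewrite -(raddf0 pi) => /piE; rewrite subr0.
  by congr (f _); rewrite -(raddf0 pi); apply/piE; rewrite subr0.
- by rewrite cG size_map.
Qed.

(** * Lee spheres of radius 1 and 2 *)

Section LeeSphere.
Variable n : nat.
Implicit Types (x y : 'rV[int]_n) (o : option ('I_n * bool)).

(* The Lee sphere of radius 1, with [Some (i, b)] standing for [(-1) ^ b * e_i]. *)
Definition unitvec o : 'rV[int]_n :=
  \row_j ((o == Some (j, false))%:R - (o == Some (j, true))%:R).

Definition oppidx o := omap (fun s => (s.1, ~~ s.2)) o.

Lemma unitvec_opp o : unitvec (oppidx o) = - unitvec o.
Proof.
apply/rowP => j; rewrite !mxE opprB; case: o => [[i b]|] //=.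
by rewrite !(inj_eq Some_inj) !xpair_eqE; case: b; case: (i == j).
Qed.

Lemma unitvec_None : unitvec None = 0.
Proof. by apply/rowP => j; rewrite !mxE. Qed.

Lemma unitvec_self i b : unitvec (Some (i, b)) 0 i = (-1) ^+ b.
Proof. by rewrite mxE !(inj_eq Some_inj) !xpair_eqE eqxx; case: b. Qed.

(** Take the sign of e_i as positive: the i-th coordinate is at least 0 on the left and at most 0 on
    the right, so [o2] must cancel [Some s]. *)
Lemma unitvec_sum_Some s o2 o3 o4 :
  unitvec (Some s) + unitvec o2 = unitvec o3 + unitvec o4 ->
  Some s <> o3 -> Some s <> o4 -> unitvec (Some s) + unitvec o2 = 0.
Proof.
case: s => i b E n3 n4; have -> : o2 = oppidx (Some (i, b)); last first.
  by rewrite unitvec_opp subrr.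
have := congr1 (fun x : 'rV_n => x 0 i) E; rewrite mxE unitvec_self !mxE /=.
by case: b n3 n4 {E} => n3 n4 /=; do 6!case: eqP => ?; subst; try congruence; lia.
Qed.

Lemma unitvec_inj : injective unitvec.
Proof.
move=> o o' E; case: o E => [[i b]|] E.
  have := congr1 (fun x : 'rV_n => x 0 i) E; rewrite unitvec_self mxE.
  by case: b {E} => /=; do 2!case: eqP => //.
case: o' E => [[i b]|] // E.
have := congr1 (fun x : 'rV_n => x 0 i) E; rewrite unitvec_self unitvec_None mxE.
by case: b {E}.
Qed.

Lemma unitvec_sum o1 o2 o3 o4 :
  unitvec o1 + unitvec o2 = unitvec o3 + unitvec o4 ->
  [\/ unitvec o1 + unitvec o2 = 0, o1 = o3 | o1 = o4].
Proof.
move=> E; have [->|n13] := pselect (o1 = o3); first by constructor 2.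
have [->|n14] := pselect (o1 = o4); first by constructor 3.
(* These serve the case [o1 = None], where [o1] and [o2] are exchanged. *)
have n23 : o2 <> o3.
  by move=> o23; apply/n14/unitvec_inj/(addIr (unitvec o2)); rewrite E o23 addrC.
have n24 : o2 <> o4.
  by move=> o24; apply/n13/unitvec_inj/(addIr (unitvec o2)); rewrite E o24.
constructor 1; case: o1 E n13 n14 => [s|] E n13 n14.
  exact: unitvec_sum_Some E n13 n14.
case: o2 E n23 n24 => [s|] E n23 n24; last by rewrite unitvec_None addr0.
by rewrite addrC in E *; exact: unitvec_sum_Some E n23 n24.
Qed.

Lemma lee_weightD x y : (lee_weight (x + y) <= lee_weight x + lee_weight y)%N.
Proof.
rewrite -big_split /=; apply: leq_sum => i _; rewrite mxE.
by move: (x 0 i) (y 0 i) => a b; lia.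
Qed.

Lemma lee_weight_unitvec o : (lee_weight (unitvec o) <= 1)%N.
Proof.
case: o => [[i b]|]; last first.
  by rewrite unitvec_None /lee_weight big1 // => j _; rewrite mxE.
rewrite /lee_weight (bigD1 i) //= unitvec_self big1 => [|j ji]; first by case: b.
by rewrite mxE !(inj_eq Some_inj) !xpair_eqE eq_sym (negbTE ji).
Qed.

Lemma lee_weight_eq0 x : lee_weight x = 0%N -> x = 0.
Proof.
move=> /eqP; rewrite sum_nat_eq0 => /forallP x0; apply/rowP => i.
by rewrite mxE; have := x0 i; rewrite implyTb => /eqP; lia.
Qed.

(** A unit step towards 0 in a nonzero coordinate lowers the weight by 1. *)
Lemma lee_weight_sub_unitvec x k : (lee_weight x <= k.+1)%N ->
  exists o, (lee_weight (x - unitvec o) <= k)%N.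
Proof.
move=> xk; have [[i xi]|x0] := pselect (exists i, x 0 i != 0); last first.
  exists None; rewrite unitvec_None subr0 /lee_weight big1 // => i _.
  by apply/eqP; rewrite absz_eq0; apply/negPn/negP => xi; apply: x0; exists i.
exists (Some (i, x 0 i < 0)); move: xk; set y := x - _.
rewrite /lee_weight (bigD1 i) //= [X in _ -> (X <= _)%N](bigD1 i) //=.
have -> : y 0 i = x 0 i - (-1) ^+ (x 0 i < 0)%R.
  by rewrite -(unitvec_self i) /y !mxE.
have -> : (\sum_(j < n | j != i) `|y 0%R j| = \sum_(j < n | j != i) `|x 0%R j|)%N.
  apply: eq_bigr => j ji; rewrite !mxE !(inj_eq Some_inj) !xpair_eqE eq_sym.
  by rewrite (negbTE ji) subr0.
move: (x 0 i) xi => a a0; set s := (\sum_(_ < _ | _) _)%N.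
by case: (ltP a 0) => /= a_sign; lia.
Qed.

Lemma lee_sphere2P x :
  lee_sphere n 2 x <-> exists o o', x = unitvec o + unitvec o'.
Proof.
split=> [/lee_weight_sub_unitvec [o /lee_weight_sub_unitvec [o']]|[o [o' ->]]].
  rewrite leqn0 => /eqP/lee_weight_eq0/subr0_eq xo; exists o, o'.
  by rewrite -xo addrC subrK.
rewrite /lee_sphere /=; apply: leq_trans (lee_weightD _ _) _.
by rewrite (leq_add (lee_weight_unitvec o) (lee_weight_unitvec o')).
Qed.

(** x lies in the translates of the sphere by 0 and by x - y, which must therefore coincide. *)
Lemma packing_inj r (C : set 'rV[int]_n) x y : C 0 -> lattice_packing r C ->
  lee_sphere n r x -> lee_sphere n r y -> C (x - y) -> x = y.
Proof.
move=> C0 pC xS yS Cxy; apply/esym/subr0_eq; rewrite -opprB; apply/eqP.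
rewrite oppr_eq0 eq_sym; apply/eqP; apply: pC => //; exists x; split.
  by exists x => //; rewrite add0r.
by exists y => //; rewrite subrK.
Qed.

End LeeSphere.

(** * From the code to T + T in the quotient *)

Theorem theorem1p1 (n : nat) (n_gt0 : (0 < n)%N)
    (n_mod6 : [\/ n = 0 %[mod 6], n = 3 %[mod 6] | n = 4 %[mod 6]]) :
  ~ exists C : set 'rV[int]_n, apll_code 2 C.
Proof.
move=> [C /apll_codeP [lC pC iC]].
have [|G [p [p_surj p_ker cardG]]] := finite_quotient lC; first by rewrite iC.
have C0 : C 0 by apply/p_ker; rewrite raddf0.
have p_inj x y : lee_sphere n 2 x -> lee_sphere n 2 y -> p x = p y -> x = y.
  move=> xS yS /eqP; rewrite -subr_eq0 -raddfB => /eqP/p_ker.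
  exact: packing_inj C0 pC xS yS.
(* Sums of two unit vectors lie in the sphere, so equalities between them lift from G to Z^n. *)
have pair_inj o1 o2 o3 o4 : p (unitvec o1) + p (unitvec o2) =
    p (unitvec o3) + p (unitvec o4) ->
    unitvec o1 + unitvec o2 = unitvec o3 + unitvec o4.
  by rewrite -!raddfD; apply: p_inj; apply/lee_sphere2P; do 2!eexists.
pose T := [set p (unitvec o) | o in [set: option ('I_n * bool)]]%SET.
have inT o : p (unitvec o) \in T by apply/imsetP; exists o.
pose U := [set x + y | x in T, y in T]%SET.
have cardU : #|U| = card_lee_sphere n 2.
  have mapU : perm_eq [seq p x | x <- fset_set (lee_sphere n 2)] (enum U).
    apply: uniq_perm; rewrite ?enum_uniq //.
      rewrite map_inj_in_uniq ?fset_uniq // => x y.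
      by rewrite !in_fset_set ?inE; [exact: p_inj|exact: finite_lee_sphere..].
    move=> q; rewrite mem_enum; apply/mapP/imset2P.
      move=> [x]; rewrite in_fset_set ?inE; last exact: finite_lee_sphere.
      move=> /lee_sphere2P [o [o' ->]] ->.
      by exists (p (unitvec o)) (p (unitvec o')); rewrite ?inT ?raddfD.
    move=> [_ _ /imsetP[o _ ->] /imsetP[o' _ ->] ->].
    exists (unitvec o + unitvec o'); last by rewrite raddfD.
    rewrite in_fset_set ?inE; last exact: finite_lee_sphere.
    by apply/lee_sphere2P; exists o, o'.
  by rewrite cardE -(perm_size mapU) size_map.
(* G has one element more than the sphere, whose image is [U]. *)
have /eqP/cards1P [g gE] : #|~: U| = 1%N.
  by have := cardsC U; rewrite cardU cardG iC; lia.
apply: (@no_almost_cover G T n _ _ _ _ _ g).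
- by rewrite -(raddf0 p) -unitvec_None.
- suff NT x : x \in T -> - x \in T.
    by move=> x; apply/idP/idP => /NT; rewrite ?opprK.
  by move=> /imsetP[o _ ->]; rewrite -raddfN -unitvec_opp.
- rewrite card_imset.
    by rewrite cardsT card_option card_prod card_ord card_bool; lia.
  move=> o o' oo'; apply: unitvec_inj; apply: p_inj oo'; apply/lee_sphere2P.
    by exists o, None; rewrite unitvec_None addr0.
  by exists o', None; rewrite unitvec_None addr0.
(* The equation 2t = 0 lifts to Z^n, which has no torsion. *)
- move=> _ /imsetP[o _ ->] E.
  have : unitvec o + unitvec o = unitvec None + unitvec None.
    by apply: pair_inj; rewrite E unitvec_None raddf0 addr0.
  rewrite unitvec_None addr0 => /rowP o0.
  rewrite (_ : unitvec o = 0) ?raddf0 //; apply/rowP => i.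
  by have := o0 i; rewrite !mxE; lia.
- move=> t1 t2 t3 t4 /imsetP[o1 _ ->] /imsetP[o2 _ ->] /imsetP[o3 _ ->].
  move=> /imsetP[o4 _ ->] /pair_inj /unitvec_sum [E|->|->].
  + by constructor 1; rewrite -raddfD E raddf0.
  + by constructor 2.
  + by constructor 3.
- move=> x; have -> : (x != g) = (x \in U).
    by rewrite -[x \in U]negbK -finset.in_setC gE inE.
  apply: (iffP imset2P) => [[t1 t2 t1T t2T ->]|[t1 [t2 [t1T t2T ->]]]].
    by exists t1, t2.
  by exists t1 t2.
- by [].
- case: n_mod6 => n6; apply/orP; [left|left|right]; lia.
Qed.
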